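(* Let $G$ be a group, $R$ a commutative $G$-graded ring with nonzero unity, and $M$ a nonzero $G$-graded $R$-module. Then every proper graded $R$-submodule of $M$ is a graded special $r$-submodule of $M$ if and only if $h(M)\subseteq T(M)$ or $Rx=M$ for all $x\in h(M)-T(M)$.
   Context: A commutative ring $R$ is $G$-graded if $R=\bigoplus_{g\in G}R_g$ with additive subgroups $R_g$ satisfying $R_gR_h\subseteq R_{gh}$; an $R$-module $M$ is $G$-graded if $M=\bigoplus_{g\in G}M_g$ with additive subgroups $M_g$ satisfying $R_gM_h\subseteq M_{gh}$. Put $h(R)=\bigcup_{g\in G}R_g$ and $h(M)=\bigcup_{g\in G}M_g$. An $R$-submodule $K$ of $M$ is graded if $K=\bigoplus_{g\in G}(K\cap M_g)$. Notation: $(K:_R M)=\{r\in R: rM\subseteq K\}$; $Ann_R(x)=\{r\in R: rx=0\}$ for $x\in M$; $T(M)=\{x\in M: Ann_R(x)\neq\{0\}\}$; $h(M)-T(M)$ is the set difference. A proper graded $R$-submodule $K$ of $M$ is a graded special $r$-submodule if whenever $a\in h(R)$ and $x\in h(M)$ satisfy $ax\in K$ and $Ann_R(x)=\{0\}$, then $a\in(K:_R M)$. *)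

(* Defs.v *)
From mathcomp Require Import all_boot all_algebra.
From mathcomp Require Import all_classical.

Set Implicit Arguments.
Unset Strict Implicit.
Unset Printing Implicit Defensive.

Import GRing.Theory.

Local Open Scope classical_set_scope.
Local Open Scope ring_scope.

Section DirectSum.
Context {I : choiceType} {V : zmodType}.

Definition subgroup_family (A : I -> set V) : Prop :=
  forall i, GRing.zmod_closed [in A i].

Definition finsupp_sections (A : I -> set V) : set (I -> V) :=
  [set f | finite_set (f @^-1` [set~ 0]) /\ forall i, A i (f i)].

(* The internal direct sum decomposition K = \bigoplus_i A i: the elements of K
   are the finite sums of elements of the A i, and such a sum determines its
   summands. *)
Definition is_direct_sum (K : set V) (A : I -> set V) : Prop :=
  K = [set \sum_(i \in [set: I]) f i | f in finsupp_sections A] /\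
  {in finsupp_sections A &,
    injective (fun f : I -> V => \sum_(i \in [set: I]) f i)}.

Definition homogeneous (A : I -> set V) : set V := \bigcup_i A i.

End DirectSum.

Section Graded.
Context {G : groupType} {R : comNzRingType}.

Record graded_ring (Rg : G -> set R) : Prop := GradedRing {
  graded_ring_subgroup : subgroup_family Rg;
  graded_ring_sum : is_direct_sum [set: R] Rg;
  graded_ring_mul : forall g h r s,
    Rg g r -> Rg h s -> Rg (g * h)%g (r * s) }.

Context {M : lmodType R}.

Record graded_module (Rg : G -> set R) (Mg : G -> set M) : Prop :=
  GradedModule {
    graded_module_subgroup : subgroup_family Mg;
    graded_module_sum : is_direct_sum [set: M] Mg;
    graded_module_scale : forall g h r x,
      Rg g r -> Mg h x -> Mg (g * h)%g (r *: x) }.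

Definition graded_submodule (Mg : G -> set M) (K : set M) : Prop :=
  GRing.submod_closed [in K] /\ is_direct_sum K (fun g => K `&` Mg g).

(* (K :_R M) *)
Definition colon (K : set M) : set R := [set r | forall m, K (r *: m)].

Definition ann (x : M) : set R := [set r | r *: x = 0].

Definition graded_special_r_submodule (Rg : G -> set R) (Mg : G -> set M)
    (K : set M) : Prop :=
  [/\ graded_submodule Mg K, K <> [set: M] &
      forall a x, homogeneous Rg a -> homogeneous Mg x ->
        K (a *: x) -> ann x = [set 0] -> colon K a].

Definition cyclic_submodule (x : M) : set M := range (fun r : R => r *: x).

End Graded.

Definition torsion {R : comNzRingType} (M : lmodType R) : set M :=
  [set x | ann x <> [set 0]].
Arguments torsion {R} M _.

(* Main.v *)
Require Import Defs.
From mathcomp Require Import all_boot all_algebra.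
From mathcomp Require Import finmap.
From mathcomp Require Import all_classical.

(** The theorem reduces to two facts about a homogeneous [x] with zero
annihilator.

If [Rx = M] then any [a] with [ax] in a submodule [K] lies in [(K : M)],
because [a(rx) = r(ax)] for every [r]; so the second alternative makes every
graded submodule special, and the first one leaves no such [x] at all.

Conversely, let every proper graded submodule be special and suppose that [Rx]
is proper. It is graded ([cyclic_submodule_graded]): multiplication by [x]
shifts degrees, so the homogeneous components of [rx] are the [r_g x], which
stay in [Rx]. Now decompose [1] into homogeneous components [e_g]. Each [e_g x]
lies in [Rx], so each [e_g] lies in [(Rx : M)] by specialness. The colon is
closed under addition, so it contains [1], that is, [Rx = M]. Working with the
components of [1] in this way avoids locating [1] in the component of the
identity of [G]. *)

Set Implicit Arguments.
Unset Strict Implicit.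
Unset Printing Implicit Defensive.

Import GRing.Theory.

Local Open Scope classical_set_scope.
Local Open Scope ring_scope.

(** Finite support is essential: a family of infinite support has sum [0] by
convention, while its image under [phi] may have finite support and a nonzero
sum. *)
Lemma fsum_morph (I : choiceType) (V W : zmodType) (phi : V -> W) (f : I -> V) :
    phi 0 = 0 -> {morph phi : u v / u + v} ->
    finite_set (f @^-1` [set~ 0]) ->
  phi (\sum_(i \in [set: I]) f i) = \sum_(i \in [set: I]) phi (f i).
Proof.
move=> phi0 phiD finf; set A := fset_set (f @^-1` [set~ 0]).
have fA i : i \notin A -> f i = 0.
  by rewrite /A in_fset_set // notin_setE /= => /contrapT.
rewrite !(fsbigTE A) ?(big_morph _ phiD phi0) // => i /fA ->.
exact: phi0.
Qed.

Lemma fsum_closed (I : choiceType) (V : zmodType) (K : set V) (f : I -> V) :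
    K 0 -> (forall u v, K u -> K v -> K (u + v)) -> (forall i, K (f i)) ->
  K (\sum_(i \in [set: I]) f i).
Proof. by move=> K0 KD Kf; apply: big_ind. Qed.

Lemma submod_closedP (R : comNzRingType) (M : lmodType R) (K : set M) :
  GRing.submod_closed [in K] <->
  [/\ K 0, forall u v, K u -> K v -> K (u + v) & forall a u, K u -> K (a *: u)].
Proof.
split=> [[]|[K0 KD KZ]].
  rewrite inE => K0 Klin.
  have Klin' a u v : K u -> K v -> K (a *: u + v).
    by move=> Ku Kv; have /set_mem := Klin a u v (mem_set Ku) (mem_set Kv).
  split=> // [u v Ku Kv|a u Ku]; first by rewrite -[u]scale1r; exact: Klin'.
  by rewrite -[_ *: _]addr0; exact: Klin'.
split=> [|a u v /set_mem Ku /set_mem Kv]; apply: mem_set => //.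
by apply: KD => //; exact: KZ.
Qed.

Lemma cyclic_submodule_closed (R : comNzRingType) (M : lmodType R) (x : M) :
  GRing.submod_closed [in cyclic_submodule x].
Proof.
apply/submod_closedP; split=> [|_ _ [r _ <-] [s _ <-]|a _ [r _ <-]].
- by exists 0; rewrite ?scale0r.
- by exists (r + s); rewrite ?scalerDl.
- by exists (a * r); rewrite ?scalerA.
Qed.

(** Multiplication by an element [x] of degree [h] sends the component of degree
[g] to that of degree [g h], so the component of degree [g] of [r x] is the
component of degree [g / h] of [r], times [x]. Uniqueness of components is
inherited from [M]. *)
Lemma cyclic_submodule_graded (G : groupType) (R : comNzRingType)
    (Rg : G -> set R) (M : lmodType R) (Mg : G -> set M) (x : M) :
    graded_ring Rg -> graded_module Rg Mg -> homogeneous Mg x ->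
  graded_submodule Mg (cyclic_submodule x).
Proof.
move=> gradR gradM [h _ Mx].
have Kclosed := cyclic_submodule_closed x.
split=> //; have [K0 KD _] := (submod_closedP _).1 Kclosed.
split; last first.
  have [_ Muniq] := graded_module_sum gradM.
  have sub f : f \in finsupp_sections (fun g => cyclic_submodule x `&` Mg g) ->
      f \in finsupp_sections Mg.
    by move=> /set_mem[finf Kf]; apply: mem_set; split=> // g; have [] := Kf g.
  by move=> f1 f2 /sub sf1 /sub sf2; exact: Muniq.
apply/seteqP; split; last first.
  by move=> _ [f [_ Kf] <-]; apply: fsum_closed => // g; have [] := Kf g.
move=> _ [r _ <-].
have [Rsum _] := graded_ring_sum gradR.
have : [set: R] r by [].
rewrite Rsum => -[c [finc Rc] <-].
have shift_bij : bijective (fun g : G => (g * h^-1)%g).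
  by exists (fun g => (g * h)%g) => g; rewrite ?mulgVK ?mulgK.
exists (fun g => c (g * h^-1)%g *: x).
  split=> [|g].
    apply: (@sub_finite_set _ _
      ((fun g : G => (g * h^-1)%g) @^-1` (c @^-1` [set~ 0]))).
      by move=> g /= cx0 c0; apply: cx0; rewrite c0 scale0r.
    apply: finite_preimage => //.
    by move=> g1 g2 _ _; exact: (bij_inj shift_bij).
  split; first by exists (c (g * h^-1)%g).
  by have := graded_module_scale gradM (Rc (g * h^-1)%g) Mx; rewrite mulgVK.
rewrite -(reindex_fsbigT _ (fun g => c g *: x) shift_bij).
by rewrite (fsum_morph (phi := fun s => s *: x)) ?scale0r // => u v;
  rewrite scalerDl.
Qed.

Lemma colon_add_closed (R : comNzRingType) (M : lmodType R) (K : set M) :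
    GRing.submod_closed [in K] ->
  colon K 0 /\ forall a b, colon K a -> colon K b -> colon K (a + b).
Proof.
move=> /submod_closedP[K0 KD _].
split=> [m|a b Ka Kb m]; first by rewrite scale0r.
by rewrite scalerDl; exact: KD.
Qed.

Lemma colon_of_generator (R : comNzRingType) (M : lmodType R) (K : set M)
    (a : R) (x : M) :
    GRing.submod_closed [in K] -> cyclic_submodule x = [set: M] ->
  K (a *: x) -> colon K a.
Proof.
move=> /submod_closedP[_ _ KZ] genx Kax m.
have : [set: M] m by [].
by rewrite -genx => -[r _ <-]; rewrite scalerA mulrC -scalerA; exact: KZ.
Qed.

(** The components of [1] are homogeneous ring elements that map [x] into [Rx],
so specialness of [Rx] would put them, hence [1], in the colon. *)
Lemma cyclic_submodule_not_special (G : groupType) (R : comNzRingType)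
    (Rg : G -> set R) (M : lmodType R) (Mg : G -> set M) (x : M) :
    graded_ring Rg -> homogeneous Mg x -> ann x = [set 0] ->
  ~ graded_special_r_submodule Rg Mg (cyclic_submodule x).
Proof.
move=> gradR hx annx [_ properK special]; apply: properK.
have [C0 CD] := colon_add_closed (cyclic_submodule_closed x).
suff C1 : colon (cyclic_submodule x) 1.
  by apply/seteqP; split=> // m _; have := C1 m; rewrite scale1r.
have [Rsum _] := graded_ring_sum gradR.
have : [set: R] 1 by [].
rewrite Rsum => -[e [_ Re] <-]; apply: fsum_closed => // g.
by apply: special annx => //; [exists g | exists (e g)].
Qed.

Theorem theorem4p24 (G : groupType) (R : comNzRingType) (Rg : G -> set R)
    (M : lmodType R) (Mg : G -> set M)
    (gradR : graded_ring Rg) (gradM : graded_module Rg Mg)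
    (M_neq0 : [set: M] <> [set 0]) :
  (forall K : set M, graded_submodule Mg K -> K <> [set: M] ->
     graded_special_r_submodule Rg Mg K)
  <->
  (homogeneous Mg `<=` torsion M \/
   forall x : M, (homogeneous Mg `\` torsion M) x ->
     cyclic_submodule x = [set: M]).
Proof.
split=> [special|gen K gradK properK].
  right=> x [hx /contrapT annx]; apply: contrapT => properRx.
  apply: (cyclic_submodule_not_special gradR hx annx).
  by apply: special => //; exact: cyclic_submodule_graded gradR gradM hx.
split=> // a x _ hx Kax annx.
case: gen => [/(_ x hx)/(_ annx)//|gen].
by apply: (colon_of_generator gradK.1 _ Kax); apply: gen; split=> // /(_ annx).
Qed.
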